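(* Let $\mathcal{L}$ be a Frattini-free Banach Lie algebra, i.e. $\mathcal{L}\in\mathbf{Sem}(P_{\mathfrak{S}^{\max}})$. Then $\mathcal{L}$ has a largest solvable Lie ideal, that is, a closed solvable Lie ideal that contains all solvable Lie ideals of $\mathcal{L}$; and $\mathcal{L}$ has a largest commutative Lie ideal, that is, a closed commutative Lie ideal that contains all commutative Lie ideals of $\mathcal{L}$.
   Context: A Banach Lie algebra is a complex Lie algebra $\mathcal{L}$ which is a Banach space in a norm such that, for some $t_{\mathcal{L}}>0$, $\|[a,b]\|\leq t_{\mathcal{L}}\|a\|\|b\|$ for all $a,b\in\mathcal{L}$. $\mathcal{L}\in\mathbf{Sem}(P_{\mathfrak{S}^{\max}})$ means that the intersection of all maximal proper closed Lie subalgebras of finite codimension in $\mathcal{L}$ is $\{0\}$ (an intersection over the empty family being $\mathcal{L}$). Put $\mathcal{L}_{[0]}=\mathcal{L}$ and $\mathcal{L}_{[n+1]}=\overline{[\mathcal{L}_{[n]},\mathcal{L}_{[n]}]}$ (closed linear span of the brackets). $\mathcal{L}$ is solvable if $\mathcal{L}_{[n]}=\{0\}$ for some $n$. (For non-closed ideals solvability is in the usual sense, equivalently solvability of the closure.) *)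

(* Defs.v *)
From mathcomp Require Import all_boot all_order all_algebra.
From mathcomp Require Import complex.
From mathcomp Require Import all_classical all_reals all_analysis.

Set Implicit Arguments.
Unset Strict Implicit.
Unset Printing Implicit Defensive.

Import Order.TTheory GRing.Theory Num.Theory.
Import numFieldNormedType.Exports.

Local Open Scope classical_set_scope.
Local Open Scope ring_scope.

(* The norm of a normed module over R[i] takes its values in R[i]; these values
   are nonnegative reals, and 0 < t in R[i] means that t is a positive real. *)
Record banachLieAlgebra (R : realType) := BanachLieAlgebra {
  banach_lie_sort :> completeNormedModType R[i];
  lie : {bilinear banach_lie_sort -> banach_lie_sort -> banach_lie_sort};
  lie_alternating : forall a, lie a a = 0;
  lie_jacobi : forall a b c,
    lie a (lie b c) + lie b (lie c a) + lie c (lie a b) = 0;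
  lie_bounded : exists2 t : R[i], 0 < t &
    forall a b, `|lie a b| <= t * `|a| * `|b| }.

Section BanachLie.
Variables (R : realType) (L : banachLieAlgebra R).
Implicit Types A B I J M N : set L.

Definition linear_subspace M : Prop := submod_closed [pred x | x \in M].

Definition lie_subalgebra M : Prop :=
  linear_subspace M /\ forall a b, M a -> M b -> M (lie L a b).

Definition lie_ideal J : Prop :=
  linear_subspace J /\ forall a b, J b -> J (lie L a b).

(* dim (L / M) is finite: finitely many vectors span L modulo M *)
Definition finite_codim M : Prop :=
  exists (n : nat) (e : 'I_n -> L), forall x : L,
    exists c : 'I_n -> R[i], M (x - \sum_(i < n) c i *: e i).

Definition proper_closed_finite_codim_subalgebra M : Prop :=
  [/\ lie_subalgebra M, closed M, finite_codim M & M != setT].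

Definition maximal_closed_finite_codim_subalgebra M : Prop :=
  proper_closed_finite_codim_subalgebra M /\
  forall N, proper_closed_finite_codim_subalgebra N -> M `<=` N -> N = M.

(* An intersection over an empty family is setT *)
Definition frattini_free : Prop :=
  \bigcap_(M in [set M | maximal_closed_finite_codim_subalgebra M]) M = [set 0].

Definition lie_span A B : set L :=
  smallest linear_subspace [set lie L a b | a in A & b in B].

Fixpoint closed_derived A (n : nat) : set L :=
  if n is n'.+1 then
    closure (lie_span (closed_derived A n') (closed_derived A n'))
  else A.

Fixpoint derived A (n : nat) : set L :=
  if n is n'.+1 then lie_span (derived A n') (derived A n') else A.

(* Solvability of a closed subalgebra, itself a Banach Lie algebra: as it is
   closed in L, closures taken in it and in L agree. *)
Definition lie_closed_solvable A : Prop :=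
  exists n, closed_derived A n = [set 0].

(* Solvability in the usual algebraic sense, for ideals that may fail to be
   closed. *)
Definition lie_solvable A : Prop := exists n, derived A n = [set 0].

Definition lie_commutative A : Prop := forall a b, A a -> A b -> lie L a b = 0.

End BanachLie.
Arguments frattini_free {R} L.

(* Main.v *)
(** Let [M] be a maximal closed subalgebra of finite codimension and [I] a
    solvable ideal not contained in [M]. The last derived ideal [A] of [I] that
    is not contained in [M] satisfies [[A, A] <= M], and [M + A] is the whole
    algebra because a subspace containing [M] is automatically closed. Hence
    [A / (A `&` M)] is a finite dimensional irreducible module, on which, as in
    Lie's theorem, every solvable ideal acts by scalars; so the brackets of
    elements of solvable ideals act by zero, and the elements acting by zero
    commute modulo [M]. Intersecting over all [M], brackets of elements of
    solvable ideals commute: the closed span of all solvable ideals is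
    metabelian, uniformly in their derived lengths. In the same way two
    commutative ideals commute, because the scalars by which one of them acts
    square to zero. *)
Require Import Defs.
From mathcomp Require Import all_boot all_order all_algebra.
From mathcomp Require Import complex lra.
From mathcomp Require Import all_classical all_reals all_analysis.
Set Implicit Arguments.
Unset Strict Implicit.
Unset Printing Implicit Defensive.
Import Order.TTheory GRing.Theory Num.Theory.
Import numFieldNormedType.Exports.
Local Open Scope classical_set_scope.
Local Open Scope ring_scope.

(** * Traces and commutators of matrices *)

Lemma mxtrace_eq_eigenvalues (C : numClosedFieldType) n (A : 'M[C]_n.+1) (l : C) :
  (forall m, eigenvalue A m -> m = l) -> \tr A = l *+ n.+1.
Proof.
move=> Al; have [s sE] := closed_field_poly_normal (char_poly A).
rewrite (monicP (char_poly_monic A)) scale1r in sE.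
have sl : all (pred1 l) s.
  apply/allP => m ms; apply/eqP/Al.
  by rewrite eigenvalue_root_char sE root_prod_XsubC.
have szs : size s = n.+1.
  by move: (size_char_poly A); rewrite sE size_prod_XsubC => -[].
have := @char_poly_trace _ n.+1 A isT.
have := coefPn_prod_XsubC (ps := s); rewrite szs sE => -> // /oppr_inj <-.
by rewrite (all_pred1P _ _ sl) big_nseq iter_addr_0 szs.
Qed.

(** A commutator that commutes with [N] makes [y] act on powers of [N] like a derivation; a factor
    [N ^+ k] survives in both terms. *)
Lemma mulr_exp_commutator (K : pzRingType) (y N : K) k :
  GRing.comm (y * N - N * y) N ->
  y * N ^+ k.+1 = N ^+ k.+1 * y + (N ^+ k * (y * N - N * y)) *+ k.+1.
Proof.
set w := y * N - N * y => wN.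
elim: k => [|k IH]; first by rewrite expr1 expr0 mul1r mulr1n addrC subrK.
rewrite [in LHS]exprSr mulrA IH mulrDl -mulrA.
have -> : y * N = N * y + w by rewrite addrC subrK.
rewrite mulrDr !mulrA -!exprSr -addrA; congr (_ + _).
by rewrite mulrnAl -mulrA wN mulrA -exprSr -mulrS.
Qed.

(** * Commuting families stable under an irreducible family of matrices *)

Section IrreducibleFamily.
Variables (C : numClosedFieldType) (n : nat).
Implicit Types (S J : 'M[C]_n.+1 -> Prop) (P : 'rV[C]_n.+1 -> Prop).

(** Subspaces are predicates, so that those given by an existential condition, such as generalized
    eigenspaces, need no basis. *)
Definition irreducible_family S : Prop := forall P,
  P 0 -> (forall c u v, P u -> P v -> P (c *: u + v)) ->
  (forall y v, S y -> P v -> P (v *m y)) ->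
  (exists2 v, v != 0 & P v) -> forall v, P v.

(** The scalar removed is the mean of the eigenvalues; a commutator is its own traceless part. *)
Definition traceless (x : 'M[C]_n.+1) := x - (\tr x / n.+1%:R)%:M.

Variables S J : 'M[C]_n.+1 -> Prop.
Hypothesis irrS : irreducible_family S.
Hypothesis JS : forall x y, J x -> S y -> J (x * y - y * x).
Hypothesis Jcomm : forall x x', J x -> J x' -> x * x' = x' * x.

(* The generalized eigenspaces of [x] are stable under [S], because [x] commutes
   with its commutators with [S]; so [x] has only one eigenvalue. *)
Lemma traceless_nilpotent_vec x (v : 'rV[C]_n.+1) : J x -> exists k, v *m traceless x ^+ k = 0.
Proof.
move=> Jx.
suff [l lP] : exists l : C, forall v : 'rV[C]_n.+1, exists k, v *m (x - l%:M) ^+ k = 0.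
  (* On an eigenvector for [m], some [(m - l) ^+ k] vanishes, so [l] is the only eigenvalue and
     equals the normalized trace. *)
  rewrite /traceless (@mxtrace_eq_eigenvalues _ _ _ l) -?[l *+ _]mulr_natr.
    by rewrite mulfK ?pnatr_eq0.
  move=> m /eigenvalueP[u ux u0]; have [k uk] := lP u.
  have : (m - l) ^+ k *: u = 0.
    rewrite -uk; elim: (k) => [|j IH]; first by rewrite !expr0 scale1r mulmx1.
    rewrite exprS [in RHS]exprS mulmxA mulmxBr ux mul_mx_scalar -scalerBl.
    by rewrite -scalemxAl -IH scalerA.
  move=> /eqP; rewrite scaler_eq0 (negPf u0) orbF expf_eq0 => /andP[_].
  by rewrite subr_eq0 => /eqP.
have [l /eigenvalueP[u ux u0]] := @eigenvalue_closed C n.+1 x isT.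
exists l; apply: irrS.
- by exists 0%N; rewrite mul0mx.
- move=> c a b [i ai] [j bj]; exists (i + j)%N.
  rewrite mulmxDl -scalemxAl exprD mulmxA ai mul0mx scaler0 add0r.
  by rewrite -exprD addnC exprD mulmxA bj mul0mx.
(* With one factor more than [a] needs, both terms of the commutation formula still begin with
   [N ^+ k], which kills [a]. *)
- move=> y a Sy [k ak]; exists k.+1; set N := x - l%:M in ak *.
  have wE : y * N - N * y = - (x * y - y * x).
    by rewrite /N mulrBr mulrBl -!mulmxE scalar_mxC !opprB subrKA.
  rewrite -mulmxA mulmxE mulr_exp_commutator; last first.
    rewrite wE; apply/commr_sym/commrN/commr_sym/commrB.
      by apply/Jcomm => //; apply: JS.
    by rewrite /GRing.comm -!mulmxE scalar_mxC.
  by rewrite mulmxDr linearMn /= exprSr -!mulmxE !mulmxA ak !mul0mx mul0rn addr0.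
- by exists u => //; exists 1%N; rewrite expr1 mulmxBr ux mul_mx_scalar subrr.
Qed.

Lemma traceless_nilpotent x : J x -> exists k, traceless x ^+ k = 0.
Proof.
move=> Jx.
have [f fP] := choice (fun i : 'I_n.+1 =>
  traceless_nilpotent_vec (delta_mx 0 i) Jx).
(* The sum dominates every [f i], so this power kills all basis vectors. *)
exists (\sum_i f i)%N; apply/row_matrixP => i; rewrite rowE row0.
by rewrite (bigD1 i) //= exprD mulmxA fP mul0mx.
Qed.

Lemma exists_common_traceless_kernel :
  exists2 v : 'rV[C]_n.+1, v != 0 & forall x, J x -> v *m traceless x = 0.
Proof.
(* A nonzero [J]-stable subspace [W] of minimal dimension is killed by each
   nilpotent [traceless x], whose image of [W] is a smaller stable subspace. *)
pose Jstable (W : 'M[C]_n.+1) := forall x, J x -> stablemx W x.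
have exW : exists r, `[< exists W, [/\ W != 0, Jstable W & \rank W = r] >].
  exists (\rank (1%:M : 'M[C]_n.+1)); apply/asboolP; exists 1%:M; split=> //.
    by rewrite -mxrank_eq0 mxrank1.
  by move=> x _; exact: submx1.
case: (ex_minnP exW) => r /asboolP[W [W0 Wst Wr]] rmin.
have WN x : J x -> W *m traceless x = 0.
  move=> Jx; apply/eqP/negP => /negP WN0; set N := traceless x in WN0.
  have WNW : (W *m N <= W)%MS.
    rewrite /N /traceless mulmxBr addmx_sub ?Wst //.
    by rewrite mul_mx_scalar -scaleNr scalemx_sub.
  have : (r <= \rank (W *m N))%N.
    apply: rmin; apply/asboolP; exists (W *m N); split => // x' Jx'.
    rewrite -mulmxA.
    have -> : N *m x' = x' *m N.
      by rewrite /N /traceless mulmxBl mulmxBr scalar_mxC !mulmxE Jcomm.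
    by rewrite mulmxA submxMr ?Wst.
  (* Equality of ranks gives [W <= W *m N]; iterating puts [W] inside [W *m N ^+ k], which is
     zero. *)
  rewrite -Wr (geq_leqif (mxrank_leqif_sup WNW)) => WWN.
  have [k Nk] := traceless_nilpotent Jx.
  have : (W <= W *m N ^+ k)%MS.
    elim: (k) => [|j IH]; first by rewrite expr0 mulmx1.
    by rewrite exprSr -mulmxE mulmxA (submx_trans WWN) ?submxMr.
  by rewrite Nk mulmx0 submx0 (negPf W0).
have /rowV0Pn[v vW v0] := W0; exists v => // x Jx.
by have [D ->] := submxP vW; rewrite -mulmxA WN ?mulmx0.
Qed.

(** The common kernel of the traceless parts is stable under [S], since it is killed by the
    commutators, which have trace zero. Being nonzero, it is everything. *)
Lemma irreducible_abelian_ideal_scalar x :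
  J x -> x = (\tr x / n.+1%:R)%:M.
Proof.
move=> Jx; apply/eqP; rewrite -subr_eq0; apply/eqP/row_matrixP => i.
rewrite rowE row0; move: x Jx.
have [] := exists_common_traceless_kernel.
pose P (v : 'rV[C]_n.+1) := forall x, J x -> v *m traceless x = 0.
move=> u u0 Pu; suff : forall v, P v by move=> /(_ (delta_mx 0 i)).
apply: irrS; last by exists u.
- by move=> x _; rewrite mul0mx.
- move=> c v w Pv Pw x Jx.
  by rewrite mulmxDl -scalemxAl Pv // Pw // scaler0 addr0.
- move=> y v Sy Pv x Jx.
  have Jxy := JS Jx Sy; have := Pv _ Jxy.
  have -> : traceless (x * y - y * x) = x * y - y * x.
    rewrite /traceless raddfB /= -!mulmxE [\tr (y *m x)]mxtrace_mulC subrr.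
    by rewrite mul0r raddf0 subr0.
  rewrite mulmxBr -!mulmxE !mulmxA => /eqP; rewrite subr_eq0 => /eqP vxy.
  move: (Pv _ Jx) => /eqP; rewrite /traceless mulmxBr subr_eq0 => /eqP vx.
  by rewrite mulmxBr -vxy vx -!mulmxA scalar_mxC subrr.
Qed.
End IrreducibleFamily.

(** * Subspaces above a closed subspace of finite codimension *)

(* Completeness of the reals, without sequences: [Q a r] says that [a]
   approximates the unknown limit up to [r]. *)
Lemma real_cauchy_center (R : realType) (Q : R -> R -> Prop) :
  (exists a r, Q a r) ->
  (forall a r a' r', Q a r -> Q a' r' -> `|a - a'| <= r + r') ->
  exists a0, forall a r, Q a r -> `|a - a0| <= r.
Proof.
(* The limit is the supremum of the left ends [a - r], all of which lie below every right end
   [a + r]. *)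
move=> [a1 [r1 Q1]] Qd; pose E := [set z | exists a r, Q a r /\ z = a - r].
have ubE a r : Q a r -> ubound E (a + r).
  move=> Qa _ [a' [r' [Qa' ->]]]; have := Qd _ _ _ _ Qa' Qa.
  by move=> /(le_trans (ler_norm _)); lra.
have E0 : E !=set0 by exists (a1 - r1); exists a1, r1.
exists (sup E) => a r Qa; rewrite ler_norml.
have h1 : a - r <= sup E.
  by apply: ub_le_sup; [exists (a + r); exact: ubE | exists a, r].
have h2 : sup E <= a + r by apply: ge_sup => //; exact: ubE.
by apply/andP; split; lra.
Qed.

(** * Completeness of the complex numbers *)

Section Complex.
Variable R : realType.
Implicit Type z : R[i].
Local Open Scope complex_scope.

Lemma norm_real_complex (x : R) : `|x%:C : R[i]| = `|x|%:C.
Proof. by rewrite normc_def /= expr0n /= addr0 sqrtr_sqr. Qed.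

Lemma normc_ge_Im z : `|complex.Im z|%:C <= `|z|.
Proof.
have := normc_ge_Re (z * 'i); rewrite ReiNIm normrN normrM.
by rewrite [`|'i|]normc_def /= expr0n expr1n add0r sqrtr1 mulr1.
Qed.

Lemma normc_le_ReIm z : `|z| <= (`|complex.Re z| + `|complex.Im z|)%:C.
Proof.
rewrite {1}[z]complexE (le_trans (ler_normD _ _)) // normrM.
rewrite [`|'i|]normc_def /= expr0n expr1n add0r sqrtr1 mul1r.
by rewrite !norm_real_complex -rmorphD.
Qed.

(** Real and imaginary parts are treated separately, and their errors add up to twice the radius. *)
Lemma complex_cauchy_center (Q : R[i] -> R -> Prop) :
  (exists c r, Q c r) ->
  (forall c r c' r', Q c r -> Q c' r' -> `|c - c'| <= (r + r')%:C) ->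
  exists c0, forall c r, Q c r -> `|c - c0| <= (r *+ 2)%:C.
Proof.
move=> [c1 [r1 Q1]] Qd.
have [a aP] : exists a, forall c r, Q c r -> `|complex.Re c - a| <= r.
  have [||a aP] := @real_cauchy_center R
      (fun a r => exists2 c, complex.Re c = a & Q c r).
  - by exists (complex.Re c1), r1, c1.
  - move=> _ r _ r' [c <- Qc] [c' <- Qc']; rewrite -lecR.
    by apply: le_trans (Qd _ _ _ _ Qc Qc'); rewrite -raddfB normc_ge_Re.
  - by exists a => c r Qc; apply: aP; exists c.
have [b bP] : exists b, forall c r, Q c r -> `|complex.Im c - b| <= r.
  have [||b bP] := @real_cauchy_center R
      (fun a r => exists2 c, complex.Im c = a & Q c r).
  - by exists (complex.Im c1), r1, c1.
  - move=> _ r _ r' [c <- Qc] [c' <- Qc']; rewrite -lecR.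
    by apply: le_trans (Qd _ _ _ _ Qc Qc'); rewrite -raddfB normc_ge_Im.
  - by exists b => c r Qc; apply: bP; exists c.
exists (a +i* b) => c r Qc; apply: le_trans (normc_le_ReIm _) _.
rewrite lecR mulr2n; case: c Qc => x y Qc /=.
by rewrite lerD // ?(aP _ _ Qc) ?(bP _ _ Qc).
Qed.
End Complex.

Section Subspaces.
Variables (R : realType) (L : banachLieAlgebra R).
Implicit Types (F M N : set L) (x y : L).
Local Open Scope complex_scope.

Lemma linear_subspaceP M : linear_subspace M <->
  M 0 /\ forall c x y, M x -> M y -> M (c *: x + y).
Proof.
split=> [[M0 MP]|[M0 MP]].
  split; first by move: M0; rewrite inE.
  by move=> c x y Mx My; have := MP c x y; rewrite !inE; apply.
by split=> [|c x y]; rewrite !inE // => Mx My; exact: MP.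
Qed.

Section Closure.
Variables (M : set L) (linM : linear_subspace M).

Lemma subspace0 : M 0. Proof. by have [] := (linear_subspaceP M).1 linM. Qed.

Lemma subspaceP c x y : M x -> M y -> M (c *: x + y).
Proof. by have [_] := (linear_subspaceP M).1 linM; apply. Qed.

Lemma subspaceD x y : M x -> M y -> M (x + y).
Proof. by rewrite -[x in M (x + _)]scale1r; exact: subspaceP. Qed.

Lemma subspaceZ c x : M x -> M (c *: x).
Proof. by move=> Mx; rewrite -[_ *: _]addr0; apply: subspaceP subspace0. Qed.

Lemma subspaceN x : M x -> M (- x).
Proof. by rewrite -scaleN1r; exact: subspaceZ. Qed.

Lemma subspaceB x y : M x -> M y -> M (x - y).
Proof. by move=> Mx My; apply: subspaceD (subspaceN My). Qed.

Lemma subspace_sum (I : Type) (r : seq I) (P : pred I) (f : I -> L) :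
  (forall i, P i -> M (f i)) -> M (\sum_(i <- r | P i) f i).
Proof. by move=> Mf; apply: big_ind => //; [exact: subspace0|exact: subspaceD]. Qed.

End Closure.

(** A real-valued norm, for which the order is total and linear arithmetic applies. *)
Let nrm x : R := complex.Re `|x|.

Let normE x : `|x| = (nrm x)%:C.
Proof. by rewrite /nrm RRe_real ?normr_real. Qed.

Let nrm_ge0 x : 0 <= nrm x.
Proof. by rewrite -ler0c -normE. Qed.

Let nrmD x y : nrm (x + y) <= nrm x + nrm y.
Proof. by rewrite -lecR rmorphD /= -!normE ler_normD. Qed.

Let nrmN x : nrm (- x) = nrm x.
Proof. by rewrite /nrm normrN. Qed.

Let closedNP F : closed F <->
  forall y, (forall e : R, 0 < e -> exists2 f, F f & nrm (y - f) < e) -> F y.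
Proof.
split=> [Fc y Fy|Fc y Fy].
  apply: Fc => B /nbhs_normP[e /= e0 eB].
  have eE : e = (complex.Re e)%:C by rewrite RRe_real // gtr0_real.
  have [f Ff fe] := Fy (complex.Re e) ltac:(by rewrite -ltcR -eE).
  by exists f; split => //; apply: eB => /=; rewrite normE eE ltcR.
apply: Fc => e e0.
have [f [Ff fe]] : F `&` [set f | `|y - f| < e%:C] !=set0.
  by apply: Fy; apply/nbhs_normP; exists e%:C; rewrite //= ltcR.
by exists f; rewrite // -ltcR -normE.
Qed.

(** If [x] is at distance at least [d > 0] from [F], the coefficients of [x] in points near [y] form
    a Cauchy family; their limit is the coefficient of [y]. *)
Lemma closed_add_line F x : linear_subspace F -> closed F ->
  closed [set y | exists c, F (y - c *: x)].
Proof.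
move=> linF Fc; have [Fx|nFx] := pselect (F x).
  suff -> : [set y | exists c, F (y - c *: x)] = F by [].
  apply/seteqP; split=> [y [c Fy]|y Fy]; last by exists 0; rewrite scale0r subr0.
  by rewrite -(subrK (c *: x) y); apply: subspaceD => //; apply: subspaceZ.
have [d d0 dF] : exists2 d : R, 0 < d & forall f, F f -> d <= nrm (x - f).
  apply/not_exists2P => nd; apply: nFx.
  apply: ((closedNP F).1 Fc) => e e0; have [//|/existsNP[f /not_implyP[Ff /negP]]] := nd e.
  by rewrite -ltNge; exists f.
apply/closedNP => y yF.
(* [c] is a coefficient of [x] in some point within [r * d] of [y]; the factor [d] turns distances
   between points into distances between coefficients. *)
pose Q c r := 0 < r /\ exists2 f, F f & nrm (y - c *: x - f) < r * d.
have exQ r : 0 < r -> exists c, Q c r.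
  move=> r0; have [z [c Fz] zr] := yF (r * d) (mulr_gt0 r0 d0).
  exists c; split=> //; exists (z - c *: x) => //.
  by rewrite opprB subrKA.
have [||c0 c0P] := @complex_cauchy_center R Q.
- by have [c Qc] := exQ 1 ltr01; exists c, 1.
- move=> c r c' r' [r0 [f Ff fr]] [r'0 [f' Ff' fr']].
  have [->|cc'] := eqVneq c c'.
    by rewrite subrr normr0 ler0c; lra.
  have cc0 : c - c' != 0 by rewrite subr_eq0.
  rewrite -(@ler_pM2r _ d%:C) ?ltcR //.
  set w := (c - c')^-1 *: (f' - f).
  have Fw : F w by apply: (subspaceZ linF); apply: subspaceB.
  (* As [w] is in [F], the left side has norm at least [d] times that of [c - c'], while the right
     side is a difference of two small errors. *)
  have pE : (c - c') *: (x - w) = (y - c' *: x - f') - (y - c *: x - f).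
    rewrite scalerBr scalerA mulfV // scale1r scalerBl !opprB.
    by rewrite [RHS](AC (3*(1*2)) ((5*2)*(4*3)*(1*6))) /= subrr addr0.
  have : `|c - c'| * d%:C <= `|c - c'| * `|x - w|.
    by rewrite ler_wpM2l // normE lecR dF.
  rewrite -normrZ pE normE => /le_trans; apply.
  rewrite -rmorphM lecR; apply: le_trans (nrmD _ _) _.
  by rewrite nrmN; lra.
- exists c0; apply: ((closedNP F).1 Fc) => e e0.
  (* The final error is at most [r * d] from [c] plus [r *+ 2 * nrm x] from replacing [c] by
     [c0]. *)
  pose r := e / (d + nrm x *+ 2 + 1).
  have D0 : 0 < d + nrm x *+ 2 + 1 by have := nrm_ge0 x; lra.
  have r0 : 0 < r by rewrite divr_gt0.
  have [c Qc] := exQ r r0; have := c0P c r Qc; case: Qc => _ [f Ff fr] cc0.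
  exists f => //.
  have -> : y - c0 *: x - f = (y - c *: x - f) + (c - c0) *: x.
    by rewrite scalerBl [RHS](AC (3*2) ((1*5*3)*(4*2))) /= subrr addr0.
  apply: le_lt_trans (nrmD _ _) _.
  have h : nrm ((c - c0) *: x) <= r *+ 2 * nrm x.
    by rewrite -lecR rmorphM /= -!normE normrZ ler_wpM2r.
  have : r * (d + nrm x *+ 2 + 1) = e by rewrite mulfVK // gt_eqF.
  nra.
Qed.

Lemma linear_subspace_add_line F x : linear_subspace F ->
  linear_subspace [set y | exists c, F (y - c *: x)].
Proof.
move=> linF; apply/linear_subspaceP; split.
  by exists 0; rewrite scale0r subr0; exact: subspace0.
move=> c y z [a Fy] [b Fz]; exists (c * a + b).
have -> : c *: y + z - (c * a + b) *: x = c *: (y - a *: x) + (z - b *: x).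
  by rewrite scalerBr scalerDl scalerA opprD addrACA.
exact: subspaceP.
Qed.

Definition spans_modulo n (e : 'I_n -> L) M : Prop :=
  forall x, exists c : 'I_n -> R[i], M (x - \sum_(i < n) c i *: e i).

(** Exchange argument: modulo [N] the relation given by [x] expresses [e i] through the other
    vectors. *)
Lemma spans_modulo_drop M N n (e : 'I_n.+1 -> L) (c : 'I_n.+1 -> R[i]) i x :
  linear_subspace N -> M `<=` N -> spans_modulo e M -> N x ->
  M (x - \sum_j c j *: e j) -> c i != 0 ->
  spans_modulo (fun j => e (lift i j)) N.
Proof.
move=> linN MN spe Nx Mx ci z; have [d Mz] := spe z.
set a := d i / c i.
exists (fun j => d (lift i j) - a * c (lift i j)).
have -> : z - \sum_j (d (lift i j) - a * c (lift i j)) *: e (lift i j) =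
          a *: x + ((z - \sum_j d j *: e j) - a *: (x - \sum_j c j *: e j)).
  under eq_bigr do rewrite scalerBl -scalerA.
  rewrite sumrB -scaler_sumr !(bigD1_ord i isT) /= scalerBr scalerDr scalerA.
  rewrite divfK // !opprB opprD.
  by rewrite [RHS](AC (1*((1*2)*(2*1))) ((2*(6*4))*(1*7)*(3*5))) /= subrr addNr !addr0.
apply: subspaceP => //; apply: subspaceB => //; first exact: MN.
by apply: subspaceZ => //; apply: MN.
Qed.

Lemma closed_finite_codim_super n : forall M (e : 'I_n -> L) N,
  linear_subspace M -> closed M -> spans_modulo e M ->
  linear_subspace N -> M `<=` N -> closed N.
Proof.
elim: n => [|n IH] M e N linM Mc spe linN MN.
  suff -> : N = M by [].
  apply/seteqP; split=> // x _; have [c] := spe x.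
  by rewrite big_ord0 subr0.
have [NM|/existsNP[x /not_implyP[Nx nMx]]] := pselect (N `<=` M).
  by suff -> : N = M by []; apply/seteqP.
have [c Mc0] := spe x.
have [i ci] : exists i, c i != 0.
  apply/not_existsP => c0; apply: nMx; move: Mc0.
  rewrite big1 ?subr0 // => i _; have /negP/negPn/eqP -> := c0 i.
  exact: scale0r.
apply: (IH [set y | exists c, M (y - c *: x)] (fun j => e (lift i j)) N).
- exact: linear_subspace_add_line.
- exact: closed_add_line.
- apply: (@spans_modulo_drop M _ n e c i x) => //.
  + exact: linear_subspace_add_line.
  + by move=> y My; exists 0; rewrite scale0r subr0.
  + by exists 1; rewrite scale1r subrr; exact: subspace0.
- exact: linN.
- move=> y [b My]; rewrite -(subrK (b *: x) y).
  by apply: subspaceD => //; [exact: MN|exact: subspaceZ].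
Qed.

(** * Bracket identities and continuity of the bracket *)

Lemma lieC a b : lie L a b = - lie L b a.
Proof.
have := lie_alternating (a + b).
rewrite linearDl !linearDr !lie_alternating add0r addr0.
by move/eqP; rewrite addr_eq0 => /eqP.
Qed.

Lemma lie_derivation x a b :
  lie L x (lie L a b) = lie L (lie L x a) b + lie L a (lie L x b).
Proof.
have := lie_jacobi x a b; rewrite -addrA => /eqP; rewrite addr_eq0 => /eqP ->.
by rewrite opprD [lie L b x]lieC linearNr opprK addrC -lieC.
Qed.

Definition closed_subspace M : Prop := linear_subspace M /\ closed M.

(** Continuity of the bracket, in the form that extends bracket conditions from generators to closed
    spans. *)
Lemma closed_subspace_preimage_lier a M :
  closed_subspace M -> closed_subspace [set b | M (lie L a b)].
Proof.
move=> [linM Mc]; split.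
  apply/linear_subspaceP; split => [|c x y /= Mx My] /=.
    by rewrite linear0r; exact: subspace0.
  by rewrite linearPr; exact: subspaceP.
apply/closedNP => y yM; apply: ((closedNP M).1 Mc) => e e0.
have [t t0 tP] := lie_bounded L.
(* The added 1 keeps [k] positive when [a = 0]. *)
pose k := complex.Re t * nrm a + 1.
have tE : t = (complex.Re t)%:C by rewrite RRe_real // gtr0_real.
have Ret0 : 0 < complex.Re t by rewrite -ltcR -tE.
have k0 : 0 < k by rewrite ltr_wpDl // mulr_ge0 // ltW.
have [f Mf fe] := yM (e / k) (divr_gt0 e0 k0).
exists (lie L a f) => //; rewrite -linearBr.
have h : nrm (lie L a (y - f)) <= complex.Re t * nrm a * nrm (y - f).
  by rewrite -lecR !rmorphM /= -!normE -tE tP.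
apply: le_lt_trans h _.
have : nrm (y - f) * k < e by rewrite -ltr_pdivlMr.
rewrite /k mulrDr mulr1 mulrC; have := nrm_ge0 (y - f); lra.
Qed.

Lemma closed_subspace_preimage_liel b M :
  closed_subspace M -> closed_subspace [set a | M (lie L a b)].
Proof.
move=> cM; have := closed_subspace_preimage_lier b cM.
suff -> : [set a | M (lie L a b)] = [set a | M (lie L b a)] by [].
apply/seteqP; split=> x /=; rewrite lieC => /(subspaceN cM.1);
  by rewrite opprK.
Qed.

(** * The action on an ideal modulo a maximal subalgebra *)

Lemma linear_subspace_span A B : linear_subspace (lie_span A B : set L).
Proof.
apply/linear_subspaceP; split=> [C [linC _]|c y z Sy Sz C [linC ABC]].
  exact: subspace0.
by apply: subspaceP => //; [apply: Sy|apply: Sz]; split.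
Qed.

Lemma lie_span_sub A B M : linear_subspace M ->
  (forall a b, A a -> B b -> M (lie L a b)) -> lie_span A B `<=` M.
Proof.
by move=> linM ABM; apply: smallest_sub => // _ [a Aa [b Bb <-]]; exact: ABM.
Qed.

Lemma mem_lie_span A B a b : A a -> B b -> lie_span A B (lie L a b).
Proof. by move=> Aa Bb; apply: sub_gen_smallest; exists a => //; exists b. Qed.

Lemma linear_subspace_set0 : linear_subspace ([set 0] : set L).
Proof.
apply/linear_subspaceP; split=> // c x y /= -> ->.
by rewrite scaler0 addr0.
Qed.

Lemma lie_ideall J a b : lie_ideal J -> J a -> J (lie L a b).
Proof. by move=> [linJ Jl] Ja; rewrite lieC; apply: subspaceN => //; exact: Jl. Qed.

Lemma lie_ideal_span A B :
  lie_ideal A -> lie_ideal B -> lie_ideal (lie_span A B : set L).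
Proof.
move=> idA idB; have linS := linear_subspace_span A B; split=> // x b.
pose C := [set b | lie_span A B (lie L x b)].
suff : lie_span A B `<=` C by apply.
apply: lie_span_sub.
  apply/linear_subspaceP; split => [|c y z Sy Sz]; rewrite /C /=.
    by rewrite linear0r; exact: (subspace0 linS).
  by rewrite linearPr; exact: (subspaceP linS).
move=> y z Ay Bz; rewrite /C /= lie_derivation; apply: (subspaceD linS).
  by apply: mem_lie_span => //; exact: idA.2.
by apply: mem_lie_span => //; exact: idB.2.
Qed.

Lemma lie_ideal_derived J n : lie_ideal J -> lie_ideal (derived J n : set L).
Proof. by move=> idJ; elim: n => //= n IH; exact: lie_ideal_span. Qed.

Lemma lie_commutative_solvable J : lie_commutative J -> lie_solvable (J : set L).
Proof.
move=> Jc; exists 1%N => /=; apply/seteqP; split.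
  by apply: lie_span_sub => //; exact: linear_subspace_set0.
by move=> _ ->; apply: subspace0; exact: linear_subspace_span.
Qed.

(** The sum [K] of [M] and [J] is a subalgebra, closed because it contains [M]; by maximality it is
    [M] or everything, and it is not [M]. *)
Lemma maximal_subalgebra_add_ideal M J :
  maximal_closed_finite_codim_subalgebra M -> lie_ideal J -> ~ J `<=` M ->
  forall x, exists2 j, J j & M (x - j).
Proof.
move=> [[[linM Ml] Mc [n [e spe]] _] Mmax] [linJ Jl] nJM.
pose K := [set x | exists2 j, J j & M (x - j)].
have linK : linear_subspace K.
  apply/linear_subspaceP; split.
    by exists 0; [exact: subspace0|rewrite subr0; exact: subspace0].
  move=> c x y [i Ji Mx] [j Jj My]; exists (c *: i + j); first exact: subspaceP.
  by rewrite opprD addrACA -scalerBr; exact: subspaceP.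
have MK : M `<=` K.
  by move=> x Mx; exists 0; [exact: subspace0|rewrite subr0].
have [KT|KT] := eqVneq K setT.
  by move=> x; have : K x by rewrite KT.
case: nJM; rewrite -(Mmax K) //.
  by move=> j Jj; exists j; rewrite // subrr; exact: subspace0.
split=> //.
- split=> // x y [i Ji Mx] [j Jj My].
  (* The bracket of [x] and [y] differs from this element of [J] by that of [x - i] and [y - j],
     both in [M]. *)
  exists (lie L i y + lie L (x - i) j).
    apply: subspaceD => //; last exact: Jl.
    by apply: lie_ideall => //; split.
  by rewrite opprD addrA -linearBl -linearBr; exact: Ml.
- exact: (closed_finite_codim_super linM Mc spe).
- by exists n, e => x; have [c Mx] := spe x; exists c; exact: MK.
Qed.

(** A mere union of ideals, used as generating set; no sum of solvable ideals has to be shown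
    solvable beforehand. *)
Definition in_solvable_ideal : set L :=
  [set x | exists I : set L, [/\ lie_ideal I, lie_solvable I & I x]].

Definition in_commutative_ideal : set L :=
  [set x | exists I : set L, [/\ lie_ideal I, lie_commutative I & I x]].

(** * The irreducible module defined by [A] and [M] *)

Section IdealRepresentation.
Variables (M A : set L).
Hypothesis maxM : maximal_closed_finite_codim_subalgebra M.
Hypothesis idA : lie_ideal A.
Hypothesis nAM : ~ A `<=` M.
Hypothesis AAM : forall a b, A a -> A b -> M (lie L a b).

Let linM : linear_subspace M. Proof. by case: maxM => -[[]]. Qed.
Let linA : linear_subspace A. Proof. by case: idA. Qed.
Let subM a b : M a -> M b -> M (lie L a b).
Proof. by case: maxM => -[[_ +] _ _ _] _; apply. Qed.

(** Any finite spanning family can be moved into [A] modulo [M]; one of least size is independent by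
    the exchange argument. *)
Lemma exists_minimal_spanning : exists n (e : 'I_n.+1 -> L),
  [/\ forall i, A (e i), spans_modulo e M &
      forall c : 'I_n.+1 -> R[i], M (\sum_i c i *: e i) -> forall i, c i = 0].
Proof.
have exP : exists n,
    `[< exists e : 'I_n -> L, (forall i, A (e i)) /\ spans_modulo e M >].
  have [[_ _ [n [e spe]] _] _] := maxM; exists n; apply/asboolP.
  have [f fP] := choice (fun i : 'I_n =>
    let: ex_intro2 j Aj Mj := maximal_subalgebra_add_ideal maxM idA nAM (e i) in
    ex_intro (fun j => A j /\ M (e i - j)) j (conj Aj Mj)).
  exists f; split=> [i|x]; first by case: (fP i).
  have [c Mc] := spe x; exists c.
  rewrite -(subrKA (\sum_i c i *: e i)) -sumrB.
  apply: subspaceD => //; apply: subspace_sum => // i _; rewrite -scalerBr.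
  by apply: subspaceZ => //; case: (fP i).
case: (ex_minnP exP) => -[|n] /asboolP[e [Ae spe]] nmin.
  (* An empty family would make [M] the whole algebra. *)
  have [[_ _ _ /eqP MT] _] := maxM; case: MT; apply/seteqP; split=> // x _.
  by have [c] := spe x; rewrite big_ord0 subr0.
exists n, e; split=> // c Mc i; apply/eqP/negP => /negP ci.
suff /nmin : `[< exists f : 'I_n -> L, (forall i, A (f i)) /\ spans_modulo f M >].
  by rewrite ltnn.
apply/asboolP; exists (fun j => e (lift i j)); split=> //.
apply: (@spans_modulo_drop M M n e c i (\sum_i c i *: e i)) => //.
by rewrite subrr; exact: subspace0.
Qed.

Section Coordinates.
Variables (n : nat) (e : 'I_n.+1 -> L) (co : L -> 'rV[R[i]]_n.+1).
Let dec (v : 'rV[R[i]]_n.+1) := \sum_i v 0 i *: e i.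
Hypothesis Ae : forall i, A (e i).
Hypothesis coP : forall x, M (x - dec (co x)).
Hypothesis indep : forall v, M (dec v) -> v = 0.

Let decP c u v : dec (c *: u + v) = c *: dec u + dec v.
Proof.
rewrite /dec scaler_sumr -big_split; apply: eq_bigr => i _ /=.
by rewrite !mxE scalerDl scalerA.
Qed.

Let Adec v : A (dec v).
Proof. by apply: subspace_sum => // i _; apply: subspaceZ. Qed.

(** Linearity of the chosen coordinates [co] comes from this uniqueness. *)
Let co_unique x v : M (x - dec v) -> co x = v.
Proof.
move=> Mx; apply/eqP; rewrite -subr_eq0; apply/eqP/indep.
have -> : dec (co x - v) = (x - dec v) - (x - dec (co x)).
  by rewrite opprB [RHS]addrC subrKA addrC -scaleN1r decP scaleN1r addrC.
exact: subspaceB.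
Qed.

Let co_linear c x y : co (c *: x + y) = c *: co x + co y.
Proof.
apply: co_unique; rewrite decP opprD addrACA -scalerBr.
exact: subspaceP.
Qed.

Let co_dec v : co (dec v) = v.
Proof. by apply: co_unique; rewrite subrr; exact: subspace0. Qed.

Let co_eq0 x : M x <-> co x = 0.
Proof.
have dec0 : dec 0 = 0 by rewrite /dec big1 // => i _; rewrite mxE scale0r.
split=> [Mx|cx]; first by apply: co_unique; rewrite dec0 subr0.
by have := coP x; rewrite cx dec0 subr0.
Qed.

(** Makes the quotient a module: the part of [x] in [M] is handled by the subalgebra property, the
    part in [A] by [AAM]. *)
Let lieAM x a : A a -> M a -> M (lie L x a).
Proof.
move=> Aa Ma; have [j Aj Mj] := maximal_subalgebra_add_ideal maxM idA nAM x.
rewrite -(subrK j x) linearDl; apply: subspaceD => //; first exact: subM.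
exact: AAM.
Qed.

(* The matrix of the action of x on A / (A `&` M), which is L / M as a vector
   space. Vectors are rows, so [rho] is an antihomomorphism. *)
Let rho x : 'M[R[i]]_n.+1 := \matrix_i co (lie L x (e i)).

Let coD x y : co (x + y) = co x + co y.
Proof. by rewrite -[x in LHS]scale1r co_linear scale1r. Qed.

Let co0 : co 0 = 0. Proof. by apply/co_eq0; exact: subspace0. Qed.

Let rhoE x a : A a -> co (lie L x a) = co a *m rho x.
Proof.
move=> Aa; rewrite -{1}(subrK (dec (co a)) a) linearDr coD.
have /co_eq0 -> : M (lie L x (a - dec (co a))).
  by apply: lieAM => //; apply: subspaceB.
rewrite add0r mulmx_sum_row /dec linear_sumr (big_morph co coD co0).
apply: eq_bigr => i _; rewrite rowK linearZr_LR /=.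
by rewrite -[_ *: lie L _ _]addr0 co_linear co0 addr0.
Qed.

Let rho_lie x y : rho (lie L x y) = rho y * rho x - rho x * rho y.
Proof.
apply/row_matrixP => i; rewrite !rowE; set v := delta_mx 0 i.
have Av := Adec v; rewrite -(co_dec v) mulmxBr -!mulmxE !mulmxA -!rhoE //;
  try exact: idA.2.
apply/eqP; rewrite eq_sym subr_eq eq_sym; apply/eqP.
by rewrite -coD -lie_derivation.
Qed.

(** A nonzero stable subspace pulls back to an ideal [N] inside [A] but not inside [M]; by
    maximality [N] and [M] span [L], so the subspace is everything. *)
Let rho_irreducible : irreducible_family (fun m => exists x, m = rho x).
Proof.
move=> P P0 PP Pstab [u u0 Pu] v.
pose N := [set a | A a /\ P (co a)].
have idN : lie_ideal N.
  split=> [|x a [Aa Pa]].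
    apply/linear_subspaceP; split; first by split; [exact: subspace0|rewrite co0].
    move=> c x y [Ax Px] [Ay Py]; split; first exact: subspaceP.
    by rewrite co_linear; exact: PP.
  split; first exact: idA.2.
  by rewrite rhoE //; apply: Pstab => //; exists x.
have nNM : ~ N `<=` M.
  move=> NM; move/eqP: u0; apply; apply: indep; apply: NM.
  by split; rewrite ?co_dec //; exact: Adec.
have [a [Aa Pa] /co_eq0 Ma] := maximal_subalgebra_add_ideal maxM idN nNM (dec v).
by rewrite -(co_dec v) -(subrK a (dec v)) coD Ma add0r.
Qed.

(** Climbing the derived series from its zero end: if brackets of [D] act by scalars, these have
    trace zero, hence vanish, so [D] acts by commuting matrices and therefore by scalars. *)
Let rho_solvable_scalar J : lie_ideal J -> lie_solvable J ->
  forall x, J x -> exists l, rho x = l%:M.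
Proof.
move=> idJ [k Jk].
suff : forall j, forall x, derived J (k - j) x -> exists l, rho x = l%:M.
  by move/(_ k); rewrite subnn.
elim=> [|j IH] x.
  rewrite subn0 Jk => ->; exists 0; apply/row_matrixP => i.
  by rewrite rowK linear0l co0 raddf0 row0.
have [kj|jk] := leqP k j.
  (* Truncated subtraction: the top of the series is already reached. *)
  have -> : (k - j.+1 = k - j)%N; last exact: IH.
  by move: kj; rewrite subnS -subn_eq0 => /eqP ->.
have kjE : (k - j = (k - j.+1).+1)%N by rewrite subnSK.
set D := derived J (k - j.+1) => Dx; rewrite kjE in IH.
have idD : lie_ideal D by exact: lie_ideal_derived.
have DD y z : D y -> D z -> rho y * rho z = rho z * rho y.
  move=> Dy Dz; have [l lE] := IH _ (mem_lie_span Dy Dz).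
  move: lE; rewrite rho_lie => lE.
  have : \tr (rho z * rho y - rho y * rho z) = 0.
    by rewrite raddfB /= -!mulmxE mxtrace_mulC subrr.
  rewrite lE mxtrace_scalar => /eqP; rewrite mulrn_eq0 /= => /eqP l0.
  by move: lE; rewrite l0 raddf0 => /eqP; rewrite subr_eq0 => /eqP.
exists (\tr (rho x) / n.+1%:R).
apply: (irreducible_abelian_ideal_scalar rho_irreducible
          (J := fun m => exists2 y, D y & m = rho y)); last by exists x.
- move=> _ _ [y Dy ->] [z ->]; exists (lie L z y); first exact: idD.2.
  by rewrite rho_lie.
- by move=> _ _ [y Dy ->] [z Dz ->]; exact: DD.
Qed.

Let rho0_lie x a : rho x = 0 -> A a -> M (lie L x a).
Proof. by move=> x0 Aa; apply/co_eq0; rewrite rhoE // x0 mulmx0. Qed.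

(** [x] and [y] are split into parts in [M] and in [A]; every bracket involving [A] falls into [M]
    by the zero action or by [AAM]. *)
Let rho0_lie2 x y : rho x = 0 -> rho y = 0 -> M (lie L x y).
Proof.
move=> x0 y0.
have [i Ai Mi] := maximal_subalgebra_add_ideal maxM idA nAM x.
have [j Aj Mj] := maximal_subalgebra_add_ideal maxM idA nAM y.
rewrite -(subrK j y) linearDr; apply: subspaceD => //; last exact: rho0_lie.
rewrite -(subrK i x) linearDl; apply: subspaceD => //; first exact: subM.
rewrite lieC; apply: subspaceN => //; rewrite linearBl; apply: subspaceB => //.
  exact: rho0_lie.
exact: AAM.
Qed.

Lemma solvable_ideals_metabelian_coord a b c d :
  in_solvable_ideal a -> in_solvable_ideal b ->
  in_solvable_ideal c -> in_solvable_ideal d ->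
  M (lie L (lie L a b) (lie L c d)).
Proof.
move=> [I1 [id1 s1 Ia]] [I2 [id2 s2 Ib]] [I3 [id3 s3 Ic]] [I4 [id4 s4 Id]].
have [la aE] := rho_solvable_scalar id1 s1 Ia.
have [lb bE] := rho_solvable_scalar id2 s2 Ib.
have [lc cE] := rho_solvable_scalar id3 s3 Ic.
have [ld dE] := rho_solvable_scalar id4 s4 Id.
by apply: rho0_lie2; rewrite rho_lie ?aE ?bE ?cE ?dE -!mulmxE scalar_mxC subrr.
Qed.

Lemma commutative_ideal_trivial_action_coord a b :
  in_commutative_ideal b -> A a -> M (lie L b a).
Proof.
move=> [J [idJ Jc Jb]] Aa.
have [l bE] := rho_solvable_scalar idJ (lie_commutative_solvable Jc) Jb.
(* [lie L b a] lies in the commutative ideal [J], so bracketing again with [b] gives zero. *)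
have : co a *m rho b *m rho b = 0.
  rewrite -!rhoE //; last exact: idA.2.
  by rewrite Jc ?co0 //; exact: lie_ideall.
rewrite bE !mul_mx_scalar => /eqP; rewrite !scaler_eq0 orbA orbb => la0.
by apply/co_eq0; rewrite rhoE // bE mul_mx_scalar; apply/eqP; rewrite scaler_eq0.
Qed.

End Coordinates.

Lemma exists_coordinates :
  exists n (e : 'I_n.+1 -> L) (co : L -> 'rV[R[i]]_n.+1),
    [/\ forall i, A (e i), forall x, M (x - \sum_i co x 0 i *: e i) &
        forall v : 'rV_n.+1, M (\sum_i v 0 i *: e i) -> v = 0].
Proof.
have [n [e [Ae spe indep]]] := exists_minimal_spanning.
have [c cP] := choice spe.
exists n, e, (fun x => \row_i c x i); split=> // [x|v /indep v0].
  by under eq_bigr do rewrite mxE; exact: cP.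
by apply/rowP => i; rewrite mxE v0.
Qed.

Lemma solvable_ideals_metabelian_mod a b c d :
  in_solvable_ideal a -> in_solvable_ideal b ->
  in_solvable_ideal c -> in_solvable_ideal d ->
  M (lie L (lie L a b) (lie L c d)).
Proof.
have [n [e [co [Ae coP indep]]]] := exists_coordinates.
exact: (solvable_ideals_metabelian_coord Ae coP indep).
Qed.

Lemma commutative_ideal_trivial_action_mod a b :
  in_commutative_ideal b -> A a -> M (lie L b a).
Proof.
have [n [e [co [Ae coP indep]]]] := exists_coordinates.
exact: (commutative_ideal_trivial_action_coord Ae coP indep).
Qed.

End IdealRepresentation.

(** Provides the ideal that serves as [A]: not inside [M], but with its brackets in [M]. *)
Lemma derived_last_not_sub M J : M 0 -> lie_solvable J -> ~ J `<=` M ->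
  exists k, ~ derived J k `<=` M /\ derived J k.+1 `<=` M.
Proof.
move=> M0 [n Jn] nJM.
have exk : exists k, `[< derived J k `<=` M >].
  by exists n; apply/asboolP; rewrite Jn => _ ->.
case: (ex_minnP exk) => -[|k] /asboolP JkM kmin; first by [].
by exists k; split=> // /asboolP /kmin; rewrite ltnn.
Qed.

(** Only the ideal [J] of [a] is compared with [M]: if it lies in [M], so does the bracket, which
    belongs to [J]. *)
Lemma solvable_ideals_metabelian_mod_maximal M a b c d :
  maximal_closed_finite_codim_subalgebra M ->
  in_solvable_ideal a -> in_solvable_ideal b ->
  in_solvable_ideal c -> in_solvable_ideal d ->
  M (lie L (lie L a b) (lie L c d)).
Proof.
move=> maxM Sa; have [J [idJ Jsolv Ja]] := Sa.
have linM : linear_subspace M by case: maxM => -[[]].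
have [JM _ _ _|nJM] := pselect (J `<=` M).
  by apply: JM; do 2 apply: lie_ideall => //.
have [k [nkM kM]] := derived_last_not_sub (subspace0 linM) Jsolv nJM.
have idk : lie_ideal (derived J k) by exact: lie_ideal_derived.
apply: (solvable_ideals_metabelian_mod maxM idk nkM) => // x y Jx Jy.
by apply: kM; exact: mem_lie_span.
Qed.

(** Here [J] itself serves as [A], its brackets being zero. *)
Lemma commutative_ideals_commute_mod_maximal M a b :
  maximal_closed_finite_codim_subalgebra M ->
  in_commutative_ideal a -> in_commutative_ideal b -> M (lie L a b).
Proof.
move=> maxM Ca [J [idJ Jc Jb]].
have linM : linear_subspace M by case: maxM => -[[]].
have [JM|nJM] := pselect (J `<=` M); first by apply: JM; exact: idJ.2.
apply: (commutative_ideal_trivial_action_mod maxM idJ nJM) => // x y Jx Jy.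
by rewrite Jc //; exact: subspace0.
Qed.

(** * Closed spans of ideals *)

Lemma frattini_free_eq0 x : frattini_free L ->
  (forall M, maximal_closed_finite_codim_subalgebra M -> M x) -> x = 0.
Proof.
move=> frL Mx.
suff : [set 0] x by [].
by rewrite -frL => M; exact: Mx.
Qed.

Lemma closed_subspace_set0 : closed_subspace [set 0].
Proof.
split; first exact: linear_subspace_set0.
exact/accessible_closed_set1/hausdorff_accessible/norm_hausdorff.
Qed.

Lemma closed_subspace_smallest (G : set L) :
  closed_subspace (smallest closed_subspace G).
Proof.
split; last by apply: closed_bigI => C [[_ Cc] _].
apply/linear_subspaceP; split=> [C [[linC _] _]|c y z Sy Sz C CP].
  exact: subspace0.
by apply: (subspaceP CP.1.1); [exact: Sy|exact: Sz].
Qed.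

Lemma lie_ideal_smallest (G : set L) : (forall a b, G b -> G (lie L a b)) ->
  lie_ideal (smallest closed_subspace G).
Proof.
move=> idG; have cJ := closed_subspace_smallest G; split=> [|a]; first exact: cJ.1.
apply: smallest_sub; first exact: closed_subspace_preimage_lier.
by move=> b Gb; apply: sub_gen_smallest; exact: idG.
Qed.

Lemma closure_lie_span_sub A B M : closed_subspace M ->
  (forall a b, A a -> B b -> M (lie L a b)) -> closure (lie_span A B) `<=` M.
Proof.
move=> [linM Mc] ABM; rewrite closureE; apply: smallest_sub => //.
exact: lie_span_sub.
Qed.

Lemma closed_derived2_eq0 J :
  (forall a b c d, J a -> J b -> J c -> J d ->
     lie L (lie L a b) (lie L c d) = 0) -> closed_derived J 2 = [set 0].
Proof.
move=> J2 /=; set D := closure (lie_span J J); apply/seteqP; split; last first.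
  move=> _ ->; apply: subset_closure.
  exact: (subspace0 (linear_subspace_span D D)).
have c0 := closed_subspace_set0.
apply: closure_lie_span_sub => // x y Dx Dy.
suff : D `<=` [set x | [set 0] (lie L x y)] by apply.
apply: closure_lie_span_sub; first exact: closed_subspace_preimage_liel.
move=> a b Ja Jb.
suff : D `<=` [set y | [set 0] (lie L (lie L a b) y)] by apply.
apply: closure_lie_span_sub; first exact: closed_subspace_preimage_lier.
by move=> c d Jc Jd; exact: J2.
Qed.

(** Each variable in turn passes from the closed span to the generators, the identity being a closed
    linear condition in it. *)
Lemma smallest_closed_subspace_metabelian (G : set L) :
  (forall a b c d, G a -> G b -> G c -> G d ->
     lie L (lie L a b) (lie L c d) = 0) ->
  let J := smallest closed_subspace G in
  forall a b c d, J a -> J b -> J c -> J d ->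
     lie L (lie L a b) (lie L c d) = 0.
Proof.
move=> G2 J a b c d Ja Jb Jc Jd; have c0 := closed_subspace_set0.
pose P (a b c d : L) := [set 0] (lie L (lie L a b) (lie L c d)).
move: d Jd; apply: (smallest_sub (X := [set d | P a b c d])).
  exact: (closed_subspace_preimage_lier c
           (closed_subspace_preimage_lier (lie L a b) c0)).
move=> d Gd; move: c Jc; apply: (smallest_sub (X := [set c | P a b c d])).
  exact: (closed_subspace_preimage_liel d
           (closed_subspace_preimage_lier (lie L a b) c0)).
move=> c Gc; move: b Jb; apply: (smallest_sub (X := [set b | P a b c d])).
  exact: (closed_subspace_preimage_lier a
           (closed_subspace_preimage_liel (lie L c d) c0)).
move=> b Gb; move: a Ja; apply: (smallest_sub (X := [set a | P a b c d])).
  exact: (closed_subspace_preimage_liel b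
           (closed_subspace_preimage_liel (lie L c d) c0)).
by move=> a Ga; exact: G2.
Qed.

Lemma smallest_closed_subspace_commutative (G : set L) :
  (forall a b, G a -> G b -> lie L a b = 0) ->
  lie_commutative (smallest closed_subspace G).
Proof.
move=> Gc a b Ja; have c0 := closed_subspace_set0.
move: b; apply: (smallest_sub (X := [set b | [set 0] (lie L a b)])).
  exact: closed_subspace_preimage_lier.
move=> b Gb; move: a Ja.
apply: (smallest_sub (X := [set a | [set 0] (lie L a b)])).
  exact: closed_subspace_preimage_liel.
by move=> a Ga; exact: Gc.
Qed.

End Subspaces.

(** * The largest solvable and the largest commutative ideal *)

Theorem corollary9p11 (R : realType) (L : banachLieAlgebra R)
    (hL : frattini_free L) :
  (exists J : set L,
     [/\ lie_ideal J, closed J, lie_closed_solvable J &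
         forall I : set L, lie_ideal I -> lie_solvable I -> I `<=` J]) /\
  (exists J : set L,
     [/\ lie_ideal J, closed J, lie_commutative J &
         forall I : set L, lie_ideal I -> lie_commutative I -> I `<=` J]).
Proof.
split.
  exists (smallest (@closed_subspace R L) (@in_solvable_ideal R L)); split.
  - apply: lie_ideal_smallest => a b [I [idI Is Ib]]; exists I; split=> //.
    exact: idI.2.
  - by case: (closed_subspace_smallest (@in_solvable_ideal R L)).
  (* The length 2 is independent of the derived lengths of the generating ideals. *)
  - exists 2%N; apply: closed_derived2_eq0.
    apply: smallest_closed_subspace_metabelian => a b c d Sa Sb Sc Sd.
    apply: frattini_free_eq0 => // M maxM.
    exact: solvable_ideals_metabelian_mod_maximal.
  - by move=> I idI Is x Ix; apply: sub_gen_smallest; exists I.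
exists (smallest (@closed_subspace R L) (@in_commutative_ideal R L)); split.
- apply: lie_ideal_smallest => a b [I [idI Ic Ib]]; exists I; split=> //.
  exact: idI.2.
- by case: (closed_subspace_smallest (@in_commutative_ideal R L)).
- apply: smallest_closed_subspace_commutative => a b Ca Cb.
  apply: frattini_free_eq0 => // M maxM.
  exact: commutative_ideals_commute_mod_maximal.
- by move=> I idI Ic x Ix; apply: sub_gen_smallest; exists I.
Qed.
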